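(* Let $W$ be a commutative wire, $B$ a skew brace, and $f\colon W\to B$ a wire morphism. Then the canonical map $\iota\colon W\to B(W)$, which sends each $w\in W$ to $\frac{w}{e}$, is a wire morphism. Moreover, there exists a unique skew brace morphism $\hat f\colon B(W)\to B$ such that $\hat f\circ\iota=f$ (composition of maps).
   Context: A wire is a triple $(W,\star,\circ)$ with $(W,\star)$ a group, $(W,\circ)$ a semigroup, and $a\circ(b\star c)=(a\circ b)\star a^{-1}\star(a\circ c)$, $(b\star c)\circ a=(b\circ a)\star a^{-1}\star(c\circ a)$ for all $a,b,c\in W$, where $a^{-1}$ is the inverse with respect to $\star$. Then $(W,\circ)$ is a monoid whose neutral element is the neutral element $e$ of $\star$. A wire is commutative if $\circ$ is commutative. A skew brace is a triple $(B,\star,\circ)$ such that $(B,\star)$ and $(B,\circ)$ are groups and $a\circ(b\star c)=(a\circ b)\star a^{-1}\star(a\circ c)$ for all $a,b,c\in B$. Wire morphisms and skew brace morphisms are maps preserving both $\star$ and $\circ$. For a commutative wire $W$, its skew brace of fractions $B(W)$ is the set $(W\times W)/\sim$, where $(u,v)\sim(u_1,v_1)$ if and only if there is $k\in W$ with $u\circ v_1\circ k=u_1\circ v\circ k$; writing $\frac{u}{v}$ for the class of $(u,v)$, its operations are $\frac{u}{v}\circ\frac{u_1}{v_1}=\frac{u\circ u_1}{v\circ v_1}$ and $\frac{u}{v}\star\frac{u_1}{v_1}=\frac{(u\circ v_1)\star(v\circ v_1)^{-1}\star(u_1\circ v)}{v\circ v_1}$. These are well defined and make $B(W)$ a commutative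 skew brace. *)

(* Defs.v *)
From HB Require Import structures.
From mathcomp Require Import all_boot.
From mathcomp Require Import boolp.

Set Implicit Arguments.
Unset Strict Implicit.
Unset Printing Implicit Defensive.

Local Open Scope group_scope.
Local Open Scope quotient_scope.

Reserved Notation "a \circ b" (at level 40, left associativity).

(* The group operation written as a star in the literature is the product [*]
   of [groupType]; its neutral element is [1] and its inverse is [_^-1]. *)

HB.mixin Record Group_hasCirc T of Group T := {
  circ : T -> T -> T;
  circA : associative circ
}.
#[short(type="circGroupType")]
HB.structure Definition CircGroup := {T of Group_hasCirc T & Group T}.

Notation "a \circ b" := (circ a b) : group_scope.

HB.mixin Record CircGroup_isWire T of CircGroup T := {
  wire_circMr : forall a b c : T,
    a \circ (b * c) = (a \circ b) * a^-1 * (a \circ c);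
  wire_circMl : forall a b c : T,
    (b * c) \circ a = (b \circ a) * a^-1 * (c \circ a)
}.
#[short(type="wireType")]
HB.structure Definition Wire := {T of CircGroup_isWire T & CircGroup T}.

HB.mixin Record Wire_isCommutative T of Wire T := {
  circC : commutative (@circ T)
}.
#[short(type="comWireType")]
HB.structure Definition ComWire := {T of Wire_isCommutative T & Wire T}.

HB.mixin Record CircGroup_isSkewBrace T of CircGroup T := {
  circ_one : T;
  circ_inv : T -> T;
  circ1x : left_id circ_one circ;
  circx1 : right_id circ_one circ;
  circVx : left_inverse circ_one circ_inv circ;
  circxV : right_inverse circ_one circ_inv circ;
  brace_circMr : forall a b c : T,
    a \circ (b * c) = (a \circ b) * a^-1 * (a \circ c)
}.
#[short(type="skewBraceType")]
HB.structure Definition SkewBrace :=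
  {T of CircGroup_isSkewBrace T & CircGroup T}.

#[short(type="comSkewBraceType")]
HB.structure Definition ComSkewBrace := {T of SkewBrace T & ComWire T}.

(* Wire morphisms and skew brace morphisms are the same thing. Since a skew
   brace need not be a wire, the notion is stated on the common
   superstructure. *)
Definition brace_morphism (A B : circGroupType) (f : A -> B) : Prop :=
  {morph f : x y / x * y} /\ {morph f : x y / x \circ y}.

Section WireTheory.
Variable W : wireType.
Implicit Types a b c : W.

Lemma wire_circx1 : right_id 1 (@circ W).
Proof.
move=> a; have := wire_circMr a 1 1; rewrite mulg1 -mulgA.
by rewrite -[LHS]mulg1 => /mulgI/(congr1 (mul a)); rewrite mulg1 mulVKg.
Qed.

Lemma wire_circ1x : left_id 1 (@circ W).
Proof.
move=> a; have := wire_circMl a 1 1; rewrite mulg1 -mulgA.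
by rewrite -[LHS]mulg1 => /mulgI/(congr1 (mul a)); rewrite mulg1 mulVKg.
Qed.

Lemma wire_circxV a b : a \circ b^-1 = a * (a \circ b)^-1 * a.
Proof.
have := wire_circMr a b b^-1; rewrite mulgV wire_circx1 => aE.
by rewrite -[LHS](mulKg ((a \circ b) * a^-1)) -aE invgM invgK.
Qed.

Lemma wire_circ_heap a x y z :
  a \circ (x * y^-1 * z) = (a \circ x) * (a \circ y)^-1 * (a \circ z).
Proof. by rewrite !wire_circMr wire_circxV !mulgA !mulgVK mulgK. Qed.

End WireTheory.

Section Fractions.
Variable W : comWireType.
Implicit Types (u v w k : W) (p q r : W * W).

HB.instance Definition _ :=
  Monoid.isComLaw.Build W 1 (@circ W) circA circC (@wire_circ1x W).

Definition frac_rel : rel (W * W) := fun p q =>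
  `[< exists k, p.1 \circ q.2 \circ k = q.1 \circ p.2 \circ k >].

Lemma frac_rel_refl : reflexive frac_rel.
Proof. by move=> p; apply/asboolP; exists 1. Qed.

Lemma frac_rel_sym : symmetric frac_rel.
Proof. by move=> p q; apply: asbool_equiv_eq; split=> -[k ?]; exists k. Qed.

Lemma frac_rel_trans : transitive frac_rel.
Proof.
move=> [u1 v1] [u v] [u2 v2] /asboolP[/= k e1] /asboolP[/= l e2].
apply/asboolP; exists (v1 \circ k \circ l) => /=.
rewrite [LHS](AC (2*3) ((1*3*4)*(2*5))) /= e1.
rewrite [LHS](AC (3*2) ((1*4*5)*(2*3))) /= e2.
by rewrite [LHS](AC (3*2) ((1*4)*(2*5*3))).
Qed.

Canonical frac_equiv :=
  EquivRel frac_rel frac_rel_refl frac_rel_sym frac_rel_trans.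

(* The underlying set of the skew brace of fractions B(W). *)
Definition fractions : Type := {eq_quot frac_equiv}.
HB.instance Definition _ := EqQuotient.on fractions.
HB.instance Definition _ := Choice.on fractions.

Definition frac u v : fractions := \pi_fractions (u, v).

Lemma fracP u v u1 v1 :
  frac u v = frac u1 v1 <-> exists k, u \circ v1 \circ k = u1 \circ v \circ k.
Proof.
split=> [/eqmodP/asboolP//|h].
by apply/eqmodP/asboolP.
Qed.

Lemma fracW (P : fractions -> Prop) :
  (forall u v, P (frac u v)) -> forall x, P x.
Proof. by move=> Pfrac; elim/quotW=> -[u v]; exact: Pfrac. Qed.

Definition pair_circ p q : W * W := (p.1 \circ q.1, p.2 \circ q.2).

Definition pair_star p q : W * W :=
  ((p.1 \circ q.2) * (p.2 \circ q.2)^-1 * (q.1 \circ p.2), p.2 \circ q.2).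

Definition pair_starV p : W * W := (p.2 * p.1^-1 * p.2, p.2).

(* The operations are computed on chosen representatives; [frac_circ] and
   [frac_star] below show that they satisfy the defining formulas on all
   representatives. *)
Definition fractions_circ (x y : fractions) : fractions :=
  \pi_fractions (pair_circ (repr x) (repr y)).

Definition fractions_star (x y : fractions) : fractions :=
  \pi_fractions (pair_star (repr x) (repr y)).

Definition fractions_starV (x : fractions) : fractions :=
  \pi_fractions (pair_starV (repr x)).

Let heap_circ (x y z a : W) :
  (x * y^-1 * z) \circ a = (x \circ a) * (y \circ a)^-1 * (z \circ a).
Proof. by rewrite !(circC _ a) wire_circ_heap. Qed.

Let repr_frac u v : exists k,
  (repr (frac u v)).1 \circ v \circ k = u \circ (repr (frac u v)).2 \circ k.
Proof. by apply/fracP; rewrite -[RHS]reprK /frac -surjective_pairing. Qed.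

Let fractions_circE u v u1 v1 :
  fractions_circ (frac u v) (frac u1 v1) = frac (u \circ u1) (v \circ v1).
Proof.
have [k e] := repr_frac u v; have [k1 e1] := repr_frac u1 v1.
apply/fracP; move: (repr _) e (repr _) e1 => [a b] /= e [a1 b1] /= e1.
exists (k \circ k1).
rewrite [LHS](AC (2*2*2) ((1*3*5)*(2*4*6))) /= e e1.
by rewrite [LHS](AC (3*3) ((1*4)*(2*5)*(3*6))).
Qed.

Let fractions_starE u v u1 v1 :
  fractions_star (frac u v) (frac u1 v1) =
  frac ((u \circ v1) * (v \circ v1)^-1 * (u1 \circ v)) (v \circ v1).
Proof.
have [k e] := repr_frac u v; have [k1 e1] := repr_frac u1 v1.
apply/fracP; move: (repr _) e (repr _) e1 => [a b] /= e [a1 b1] /= e1.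
exists (k \circ k1); rewrite !heap_circ; congr (_ * _^-1 * _).
- rewrite [LHS](AC (2*2*2) ((1*3*5)*(2*4*6))) /= e.
  by rewrite [LHS](AC (3*3) ((1*5)*(2*4)*(3*6))).
- by rewrite [X in X \circ _]circC.
- rewrite [LHS](AC (2*2*2) ((1*4*6)*(2*3*5))) /= e1.
  by rewrite [LHS](AC (3*3) ((1*5)*(4*2)*(6*3))).
Qed.

Let frac_starV u v :
  fractions_starV (frac u v) = frac (v * u^-1 * v) v.
Proof.
have [k e] := repr_frac u v; apply/fracP; move: (repr _) e => [a b] /= e.
exists k; rewrite /= !heap_circ.
by rewrite e (circC v b).
Qed.

Lemma fracMr k u v : frac (u \circ k) (v \circ k) = frac u v.
Proof.
by apply/fracP; exists 1; rewrite -(circA u k v) (circC k).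
Qed.

Lemma fracvv v : frac v v = frac 1 1.
Proof. by rewrite -(fracMr v 1 1) wire_circ1x. Qed.

Let frac_star_same u u1 v :
  fractions_star (frac u v) (frac u1 v) = frac (u * v^-1 * u1) v.
Proof. by rewrite fractions_starE -heap_circ fracMr. Qed.

Let fracW3 (P : fractions -> fractions -> fractions -> Prop) :
  (forall u u1 u2 v, P (frac u v) (frac u1 v) (frac u2 v)) ->
  forall x y z, P x y z.
Proof.
move=> h; elim/fracW=> u v; elim/fracW=> u1 v1; elim/fracW=> u2 v2.
rewrite -(fracMr (v1 \circ v2) u v) -(fracMr (v \circ v2) u1 v1).
rewrite -(fracMr (v \circ v1) u2 v2).
by rewrite (circA v1) (circC v1 v) -circA (circC v2) -(circA v).
Qed.

Let starA : associative fractions_star.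
Proof. by apply: fracW3 => u u1 u2 v; rewrite !frac_star_same !mulgA. Qed.

Let star1x : left_id (frac 1 1) fractions_star.
Proof.
by elim/fracW=> u v; rewrite -(fracvv v) frac_star_same mulgV mul1g.
Qed.

Let starx1 : right_id (frac 1 1) fractions_star.
Proof. by elim/fracW=> u v; rewrite -(fracvv v) frac_star_same mulgVK. Qed.

Let starVx : left_inverse (frac 1 1) fractions_starV fractions_star.
Proof.
elim/fracW=> u v.
by rewrite frac_starV frac_star_same mulgK mulgVK fracvv.
Qed.

Let starxV : right_inverse (frac 1 1) fractions_starV fractions_star.
Proof.
elim/fracW=> u v.
by rewrite frac_starV frac_star_same !mulgA mulgVK mulgV mul1g fracvv.
Qed.

HB.instance Definition _ :=
  isGroup.Build fractions starA star1x starx1 starVx starxV.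

Let fractions_circA : associative fractions_circ.
Proof.
by apply: fracW3 => u u1 u2 v; rewrite !fractions_circE !circA.
Qed.

HB.instance Definition _ := Group_hasCirc.Build fractions fractions_circA.

Let fractions_circC : commutative fractions_circ.
Proof.
by elim/fracW=> u v; elim/fracW=> u1 v1; rewrite !fractions_circE (circC u) (circC v).
Qed.

Let fractions_circMr (x y z : fractions) :
  x \circ (y * z) = (x \circ y) * x^-1 * (x \circ z).
Proof.
move: x y z; apply: fracW3 => u u1 u2 v.
change (fractions_circ (frac u v) (fractions_star (frac u1 v) (frac u2 v)) =
  fractions_star (fractions_star (fractions_circ (frac u v) (frac u1 v))
    (fractions_starV (frac u v))) (fractions_circ (frac u v) (frac u2 v))).
rewrite frac_star_same frac_starV !fractions_circE -(fracMr v _ v) !frac_star_same.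
by rewrite heap_circ wire_circ_heap !mulgA mulgVK mulgK.
Qed.

Let fractions_circMl (x y z : fractions) :
  (y * z) \circ x = (y \circ x) * x^-1 * (z \circ x).
Proof.
have circC' := fractions_circC : forall a b : fractions, a \circ b = b \circ a.
by rewrite !(circC' _ x) fractions_circMr.
Qed.

HB.instance Definition _ :=
  CircGroup_isWire.Build fractions fractions_circMr fractions_circMl.
HB.instance Definition _ := Wire_isCommutative.Build fractions fractions_circC.

Definition fractions_circV (x : fractions) : fractions :=
  \pi_fractions ((repr x).2, (repr x).1).

Let circ1frac : left_id (frac 1 1) fractions_circ.
Proof. by elim/fracW=> u v; rewrite fractions_circE !wire_circ1x. Qed.

Let circfrac1 : right_id (frac 1 1) fractions_circ.
Proof. by elim/fracW=> u v; rewrite fractions_circE !wire_circx1. Qed.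

Let frac_circV u v : fractions_circV (frac u v) = frac v u.
Proof.
have [k e] := repr_frac u v; apply/fracP; move: (repr _) e => [a b] /= e.
by exists k; rewrite (circC b) -e (circC a).
Qed.

Let circVfrac : left_inverse (frac 1 1) fractions_circV fractions_circ.
Proof.
by elim/fracW=> u v; rewrite frac_circV fractions_circE (circC v) fracvv.
Qed.

Let circfracV : right_inverse (frac 1 1) fractions_circV fractions_circ.
Proof.
by elim/fracW=> u v; rewrite frac_circV fractions_circE (circC v) fracvv.
Qed.

HB.instance Definition _ := CircGroup_isSkewBrace.Build fractions
  circ1frac circfrac1 circVfrac circfracV fractions_circMr.

Lemma frac_star u v u1 v1 :
  frac u v * frac u1 v1 =
  frac ((u \circ v1) * (v \circ v1)^-1 * (u1 \circ v)) (v \circ v1).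
Proof. exact: fractions_starE. Qed.

Lemma frac_circ u v u1 v1 :
  frac u v \circ frac u1 v1 = frac (u \circ u1) (v \circ v1).
Proof. exact: fractions_circE. Qed.

Definition fractions_iota w : fractions := frac w 1.

End Fractions.

(* Main.v *)
(* A morphism [g] extending [f] must satisfy [f v \circ g (u/v) = f u], hence
   [g (u/v) = (f v)^-1 \circ f u], the inverse being taken for [\circ]. This
   formula is independent of the representative because the image of [f] is
   [\circ]-commutative, and it respects the star operation because fractions
   may be put over a common denominator [v] and left [\circ]-multiplication by
   [(f v)^-1] preserves the ternary operation [x * y^-1 * z]. *)
Require Import Defs.
From mathcomp Require Import all_boot.
From mathcomp Require Import boolp.

Set Implicit Arguments.
Unset Strict Implicit.
Unset Printing Implicit Defensive.

Local Open Scope group_scope.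

Section SkewBraceTheory.
Variable B : skewBraceType.
Implicit Types a b x y z : B.

(** Distributivity over [1 * 1] gives [x = x * a^-1 * x] for [x = a \circ 1]; cancel [x]. *)
Lemma brace_circ_unit a : a \circ 1 = a.
Proof.
have := brace_circMr a 1 1; rewrite mulg1 -mulgA.
by rewrite -[LHS]mulg1 => /mulgI/(congr1 (mul a)); rewrite mulg1 mulVKg.
Qed.

Lemma circ_one1 : circ_one = 1 :> B.
Proof. by rewrite -[LHS]brace_circ_unit circ1x. Qed.

Lemma brace_circxV a b : a \circ b^-1 = a * (a \circ b)^-1 * a.
Proof.
have := brace_circMr a b b^-1; rewrite mulgV brace_circ_unit => aE.
by rewrite -[LHS](mulKg ((a \circ b) * a^-1)) -aE invgM invgK.
Qed.

Lemma brace_circ_heap a x y z :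
  a \circ (x * y^-1 * z) = (a \circ x) * (a \circ y)^-1 * (a \circ z).
Proof. by rewrite !brace_circMr brace_circxV !mulgA !mulgVK mulgK. Qed.

Lemma circKx a : cancel (circ a) (circ (circ_inv a)).
Proof. by move=> b; rewrite circA circVx circ1x. Qed.

Lemma circVKx a : cancel (circ (circ_inv a)) (circ a).
Proof. by move=> b; rewrite circA circxV circ1x. Qed.

Lemma circxK a : cancel (circ^~ a) (circ^~ (circ_inv a)).
Proof. by move=> b; rewrite /= -circA circxV circx1. Qed.

(** Lets denominators move past numerators in the image of [f], although [B] itself need not be
    commutative. *)
Lemma circ_commV a b :
  a \circ b = b \circ a -> circ_inv a \circ b = b \circ circ_inv a.
Proof. by move=> ab; apply: (can_inj (circKx a)); rewrite circVKx circA ab circxK. Qed.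

End SkewBraceTheory.

Section Extension.
Variables (W : comWireType) (B : skewBraceType) (f : W -> B).
Hypothesis hf : brace_morphism f.
Implicit Types u v : W.

Lemma brace_morphism_inv u : f u^-1 = (f u)^-1.
Proof.
have [fM _] := hf; have f1 : f 1 = 1.
  by apply: (mulgI (f 1)); rewrite -fM !mulg1.
by apply: (mulgI (f u)); rewrite -fM !mulgV.
Qed.

Lemma brace_morphism_comm u v : f u \circ f v = f v \circ f u.
Proof. by rewrite -!hf.2 circC. Qed.

Definition fractions_extension (x : fractions W) : B :=
  circ_inv (f (repr x).2) \circ f (repr x).1.

Lemma fractions_extensionE u v :
  fractions_extension (frac u v) = circ_inv (f v) \circ f u.
Proof.
have : frac (repr (frac u v)).1 (repr (frac u v)).2 = frac u v.
  by rewrite -[RHS]reprK /frac -surjective_pairing.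
rewrite /fractions_extension; case: (repr _) => a b /= /fracP[k].
(* The factor [f k] cancels because it is invertible in [B]. *)
move=> /(congr1 f); rewrite !hf.2 => /(can_inj (@circxK _ _)) e.
apply: (can_inj (circKx (f b))); rewrite circVKx circA.
rewrite -(circ_commV (brace_morphism_comm v b)) -circA (brace_morphism_comm b).
by rewrite -e (brace_morphism_comm a) circKx.
Qed.

Lemma fractions_extension_circ :
  {morph fractions_extension : x y / x \circ y}.
Proof.
elim/fracW=> u v; elim/fracW=> u1 v1.
rewrite frac_circ !fractions_extensionE !hf.2.
(* With this order of factors, [f v] meets its inverse at once; [f v1] then passes [f u] to reach
   its own. *)
apply: (can_inj (circKx (f v1 \circ f v))).
rewrite {1}(brace_morphism_comm v1) circVKx -!circA circVKx !circA.
rewrite (brace_morphism_comm v1) -!circA; congr (_ \circ _).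
by rewrite circVKx.
Qed.

Lemma fractions_extension_star :
  {morph fractions_extension : x y / x * y}.
Proof.
elim/fracW=> u v; elim/fracW=> u1 v1.
(* All three fractions now have denominator [v \circ v1], whose image also is the inverted middle
   term of the numerator; the heap law sends that term to [1]. *)
rewrite frac_star -(fracMr v1 u v) -(fracMr v u1 v1) (circC v1 v).
rewrite !fractions_extensionE !hf.1 brace_morphism_inv brace_circ_heap.
by rewrite circVx circ_one1 invg1 mulg1.
Qed.

End Extension.

Lemma fractions_iota_morphism (W : comWireType) :
  brace_morphism (@fractions_iota W).
Proof.
split=> u v; rewrite /fractions_iota; last by rewrite frac_circ wire_circ1x.
by rewrite frac_star !wire_circx1 invg1 mulg1.
Qed.

Theorem proposition2p25 (W : comWireType) (B : skewBraceType) (f : W -> B)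
    (hf : brace_morphism f) :
  brace_morphism (@fractions_iota W) /\
  exists! fhat : fractions W -> B,
    brace_morphism fhat /\ fhat \o @fractions_iota W = f.
Proof.
split; first exact: fractions_iota_morphism.
exists (fractions_extension f); split.
  split; first split.
  - exact: fractions_extension_star.
  - exact: fractions_extension_circ.
  apply/funext => w /=; rewrite /fractions_iota fractions_extensionE //.
  apply: (can_inj (circKx (f 1))).
  by rewrite circVKx -hf.2 wire_circ1x.
move=> g [[_ gM] gf]; apply/funext; elim/fracW=> u v.
rewrite fractions_extensionE //; apply: (can_inj (circKx (f v))).
(* It remains to see that [u/1] equals [(v/1) \circ (u/v)] in the fractions. *)
rewrite circVKx -gf /= -gM /fractions_iota frac_circ wire_circ1x.
by rewrite -(fracMr v u 1) wire_circ1x circC.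
Qed.
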